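(* Let $\mathbf{n}=(n_1,\ldots,n_d)$ be a tuple of positive integers and let $\rho\in[d]$. Then, in the polynomial ring in the variables $x_{s,t,i}$ ($s,t\in[d]$, $i\in[n_t]$), $$\sum_{T\in\mathcal{T}_\rho(\mathbf{n})}\ \prod_{s,t\in[d],\,i\in[n_t]}x_{s,t,i}^{\mathrm{ch}_s(t,i)}=\prod_{s\in[d]}\Bigg(\sum_{t\in[d],\,i\in[n_t]}x_{s,t,i}\Bigg)^{n_s-1}\times \sum_{A\in\mathrm{Cay}_{\rho,d}}\ \prod_{(s,t)\in A}\Bigg(\sum_{i\in[n_t]}x_{s,t,i}\Bigg).$$
   Context: For a tuple $\mathbf{n}=(n_1,\ldots,n_d)$ of positive integers, a multitype Cayley tree of profile $\mathbf{n}$ is a tree (connected acyclic graph) with vertex set $V_{\mathbf{n}}=\{(t,i): t\in[d],\ i\in[n_t]\}$; the vertex $(t,i)$ has type $t$ and label $i$. A rooted tree has one distinguished root vertex and its edges are oriented toward the root. $\mathcal{T}_\rho(\mathbf{n})$ is the set of rooted multitype Cayley trees of profile $\mathbf{n}$ whose root vertex has type $\rho$. For $T\in\mathcal{T}_\rho(\mathbf{n})$, $\mathrm{ch}_s(t,i)$ denotes the number of children of type $s$ of the vertex $(t,i)$. $\mathrm{Cay}_{\rho,d}$ is the set of (unitype) trees with vertex set $[d]$ rooted at vertex $\rho$, with edges oriented toward the root; for $A\in\mathrm{Cay}_{\rho,d}$, $(s,t)\in A$ means the oriented edge from $s$ to $t$ belongs to $A$. *)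

(* Defs.v *)
From HB Require Import structures.
From mathcomp Require Import all_boot all_order all_algebra.
From mathcomp Require Import mpoly.

Set Implicit Arguments.
Unset Strict Implicit.
Unset Printing Implicit Defensive.

Import GRing.Theory.
Local Open Scope ring_scope.

Section Trees.
Variable V : finType.
Implicit Types (E : {set {set V}}) (T : {set {set V}} * V) (v w : V).

(* A simple graph on V is its edge set, a set of two-element subsets of V. *)
Definition simple_graph E : bool := [forall e in E, #|e| == 2].

Definition adj E : rel V := [rel v w | (v != w) && ([set v; w] \in E)].

Definition connected_graph E : bool :=
  [forall v, forall w, connect (adj E) v w].

(* [ucycleb (adj E) c] says that c is a closed walk with distinct vertices; it
   is a cycle of the graph when it has at least three vertices. The bound on k
   loses nothing, as the vertices of c are distinct. *)
Definition acyclic_graph E : bool :=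
  [forall k : 'I_(#|V|.+1), forall c : k.-tuple V,
     ucycleb (adj E) c ==> (k < 3)%N].

Definition is_tree E : bool :=
  [&& simple_graph E, connected_graph E & acyclic_graph E].

(* A rooted tree is a pair (edge set, root). *)
Definition rooted_trees : {set {set {set V}} * V} :=
  [set T | is_tree T.1].

(* [oriented T v w]: {v, w} is an edge of T and is oriented from v to w, that
   is, the simple path of T from v to the root has w as its second vertex, so
   that v is a child of w. *)
Definition oriented T : rel V := [rel v w |
  [exists k : 'I_#|V|, exists p : k.-tuple V,
     [&& path (adj T.1) v (w :: p), uniq [:: v, w & p] & last w p == T.2]]].

End Trees.

Section Multitype.
Variables (d : nat) (n : 'I_d -> nat).

Definition vertex : finType := {t : 'I_d & 'I_(n t)}.

Definition vtx (t : 'I_d) (i : 'I_(n t)) : vertex :=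
  Tagged (fun t => 'I_(n t)) i.

Definition multitype_trees (rho : 'I_d) : {set {set {set vertex}} * vertex} :=
  [set T in rooted_trees vertex | tag T.2 == rho].

Definition ch (T : {set {set vertex}} * vertex) (s : 'I_d)
    (t : 'I_d) (i : 'I_(n t)) : nat :=
  #|[set u : vertex | oriented T u (vtx i) & tag u == s]|.

(* [{mpoly R[m]}] has its variables indexed by 'I_m, so the triples (s, t, i)
   are numbered by [enum_rank]. *)
Definition nvars : nat := #|{: 'I_d * vertex}|.

Definition xvar (R : comNzRingType) (s t : 'I_d) (i : 'I_(n t)) :
    {mpoly R[nvars]} :=
  'X_(enum_rank (s, vtx i)).

End Multitype.

Definition Cay (d : nat) (rho : 'I_d) : {set {set {set 'I_d}} * 'I_d} :=
  [set A in rooted_trees 'I_d | A.2 == rho].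

Arguments ch {d n} T s t i.
Arguments xvar {d n} R s t i.

(* Main.v *)
Require Import Defs.
From HB Require Import structures.
From mathcomp Require Import all_boot all_order all_algebra.
From mathcomp Require Import mpoly perm.

Set Implicit Arguments.
Unset Strict Implicit.
Unset Printing Implicit Defensive.

Import GRing.Theory.
Local Open Scope ring_scope.

(** A rooted forest on [V] is encoded by its parent function [V -> option V],
    and [F(W)] denotes the sum over forests [f] of [\prod_v W v (f v)].  The
    key fact is that if [a] and [b] have the same outgoing weights, then [F] is
    unchanged when the weights of all edges into [a] are moved to the edges into
    [b].  Indeed moving the edges into [a] to [b] in a forest [f] gives a forest
    unless the path from [b] goes through [a], and in that case one first
    exchanges the parents of [a] and [b], which preserves the weight.

    Moving all weights to one representative per type makes every other vertex
    a leaf with freely chosen parent; this gives the powers of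
    [\sum_(t, i) x_(s,t,i)], and the representatives carry a forest on types.

    To pass from forests to trees, a root of type [rho] gets weight ['X], a root
    of any other type gets weight 0, and one takes the coefficient of ['X]. *)

(** * Parent functions and forests *)

Section Grounded.
Variable V : finType.
Implicit Types (f g : V -> option V) (u v : V) (o : option V).

(* Iterating [f] from [o] ends at [None], that is, beyond a root. *)
Definition grounded f o := fconnect (obind f) o None.

Definition forest f := [forall v, grounded f (Some v)].

Lemma grounded_None f : grounded f None.
Proof. exact: connect0. Qed.

Lemma grounded_Some f v : grounded f (Some v) = grounded f (f v).
Proof.
apply/idP/idP => [/iter_findex|]; last first.
  by apply: connect_trans; apply: connect1; rewrite /= eqxx.
case: findex => [//|k]; rewrite iterSr /= /grounded => <-.
exact: fconnect_iter.
Qed.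

(** The number of steps to [None] serves as a rank: it founds the induction [grounded_ind] and shows
    that a path in a forest never returns. *)
Lemma findex_None_lt f v : grounded f (Some v) ->
  (findex (obind f) (f v) None < findex (obind f) (Some v) None)%N.
Proof.
move=> /iter_findex; case: findex => [//|k]; rewrite iterSr ltnS /= => fk.
have [lt_k|le_k] := ltnP k (order (obind f) (f v)).
  by rewrite -{1}fk findex_iter.
apply: leq_trans le_k; apply: ltnW; apply: findex_max.
by rewrite -fk fconnect_iter.
Qed.

Lemma grounded_ind f (P : option V -> Prop) :
    P None -> (forall v, grounded f (f v) -> P (f v) -> P (Some v)) ->
  forall o, grounded f o -> P o.
Proof.
move=> P0 PS o; have [k] := ubnP (findex (obind f) o None).
elim: k o => // k IHk [v|//] ltk gv; apply: PS; first by rewrite -grounded_Some.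
by apply: IHk; rewrite -?grounded_Some //;
  apply: leq_trans (findex_None_lt gv) ltk.
Qed.

Lemma grounded_loop f v : f v = Some v -> ~~ grounded f (Some v).
Proof.
move=> fv; apply/negP => gv.
have H o : grounded f o -> o <> Some v.
  move=> go; elim/grounded_ind: o / go => // u gu IH [uv].
  by apply: IH; rewrite uv.
exact: H gv erefl.
Qed.

Lemma forest_rank f : forest f ->
  exists ht : V -> nat, forall v u, f v = Some u -> (ht u < ht v)%N.
Proof.
move=> /forallP ff; exists (fun v => findex (obind f) (Some v) None) => v u fv.
by rewrite -fv; apply: findex_None_lt.
Qed.

Lemma eq_grounded f g : f =1 g -> grounded f =1 grounded g.
Proof. by move=> fg o; apply: eq_fconnect => -[v|] /=. Qed.

Lemma eq_forest f g : f =1 g -> forest f = forest g.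
Proof. by move=> /eq_grounded fg; apply: eq_forallb => v; rewrite fg. Qed.

(* The loop at [v] makes every vertex whose path meets [v] non-grounded. *)
Definition cut v f : V -> option V := [eta f with v |-> Some v].
Arguments cut v f u /.

Lemma cut_diag v f : ~~ grounded (cut v f) (Some v).
Proof. by apply: grounded_loop; rewrite /= eqxx. Qed.

Lemma cut_groundedP v f u : grounded (cut v f) (Some u) ->
  u != v /\ cut v f u = f u.
Proof.
have [->|nuv _] := eqVneq u v; first by rewrite (negbTE (cut_diag v f)).
by rewrite /= (negbTE nuv).
Qed.

(** Ranks decrease along the path from [f v], so it stays below the rank of [v] and never meets the
    loop there. *)
Lemma grounded_cut v f : grounded f (Some v) -> grounded (cut v f) (f v).
Proof.
move=> gv; have lt_v := findex_None_lt gv.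
rewrite grounded_Some in gv;
  elim/grounded_ind: (f v) / gv lt_v => [_|u gu IH lt_u].
  exact: grounded_None.
rewrite grounded_Some /=.
have [uv|_] := eqVneq u v; first by rewrite uv ltnn in lt_u.
apply: IH; apply: ltn_trans lt_u; apply: findex_None_lt.
by rewrite grounded_Some.
Qed.

Lemma cut_grounded v f o : grounded (cut v f) o -> grounded f o.
Proof.
move=> go; elim/grounded_ind: o / go => [|u gu]; first exact: grounded_None.
move: gu; rewrite -grounded_Some => /cut_groundedP[_ ->].
by rewrite grounded_Some.
Qed.

(** * Redirecting to [b] the edges into [a] *)

Section Merge.
Variables a b : V.
Hypothesis neq_ab : a != b.

Let pi : V -> V := [eta id with a |-> b].
Let swap f : V -> option V := f \o tperm a b.
Let push f : V -> option V := omap pi \o f.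

(* Once the edges out of [a] and [b] are removed, [f] splits into a part
   draining to its roots, a part draining to [a] and a part draining to [b].
   For a forest [f], [P f] fails iff [f b] is in the part of [a]; if [push f] is
   a forest, [Q f] fails iff [f a] is in the part of [a]. *)
Let P f := grounded (cut a f) (Some b).
Let Q f := grounded (cut a f) (f a).

Let pi_neq u : u != a -> pi u = u.
Proof. by rewrite /pi /= => /negbTE->. Qed.
Let pi_a : pi a = b.
Proof. by rewrite /pi /= eqxx. Qed.
Let pushE f v : push f v = omap pi (f v). Proof. by []. Qed.

(** The path of [push f] from [b] never visits [a]. If it used a redirected edge, it would be back
    at [b], and the rest of it would already give [P f]; otherwise it is a path of [cut a f]. *)
Lemma forest_push_P f : forest (push f) -> P f.
Proof.
move=> /forallP/(_ b); have : Some b != Some a by rewrite eq_sym.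
have H o : grounded (push f) o -> o != Some a -> grounded (cut a f) o \/ P f.
  move=> go; elim/grounded_ind: o / go => [|v _ IH nva].
    by left; apply: grounded_None.
  rewrite grounded_Some /= ifN //; move: IH; rewrite pushE.
  case: (f v) => [u|_]; last by left; apply: grounded_None.
  have [->|nua] := eqVneq u a; rewrite /= ?pi_a ?(pi_neq nua).
    by case; [rewrite eq_sym|right|right].
  by apply.
by move=> n g; case: (H _ g n).
Qed.

(** Paths of [f] that avoid [a] are unchanged by [push]. Any other path is followed until it is
    about to enter [a]; it then jumps to [b], whose path avoids [a] by [P f]. *)
Lemma forest_P_push f : forest f -> P f -> forest (push f).
Proof.
move=> ff Pf.
have H o : grounded (cut a f) o -> grounded (push f) o.
  move=> go; elim/grounded_ind: o / go => [|v gv IH];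
    first exact: grounded_None.
  move: (gv); rewrite -grounded_Some => /cut_groundedP[_ E].
  rewrite grounded_Some pushE -E; rewrite E in gv IH *.
  case: (f v) gv IH => // u gu.
  by rewrite /= pi_neq //; case: (cut_groundedP gu).
apply/forallP=> v; have gv := forallP ff v.
elim/grounded_ind: (Some v) / gv => [|u _ IH]; first exact: grounded_None.
rewrite grounded_Some pushE; case: (f u) IH => // w gw /=.
by have [->|/pi_neq->] := eqVneq w a; rewrite ?pi_a //; apply: H.
Qed.

(** The case where redirection alone works. Conversely, [Q f] makes [a] grounded for [f], so the
    redirected edges can be moved back from [b] to [a]. *)
Lemma forest_push_keep f : forest f && P f = forest (push f) && Q f.
Proof.
apply/andP/andP=> [[ff Pf]|[pf Qf]].
  by split; [apply: forest_P_push|apply/grounded_cut/(forallP ff)].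
have Pf := forest_push_P pf; split=> //.
have ga : grounded f (Some a) by rewrite grounded_Some; apply: cut_grounded Qf.
apply/forallP=> v; have gv := forallP pf v.
elim/grounded_ind: (Some v) / gv => [|u _]; first exact: grounded_None.
rewrite grounded_Some pushE; case: (f u) => // w /=.
by have [->|/pi_neq->] := eqVneq w a.
Qed.

(** The complementary case: the path from [b] runs through [a], so redirection alone would close a
    cycle. After the swap, [b] continues along the old path from [a] to a root, and the old path
    from [b] to [a] now leads from [a] to [b]. *)
Lemma forest_swap_push f :
  forest f && ~~ P f = forest (push (swap f)) && ~~ Q (swap f).
Proof.
set g := swap f.
have ga : g a = f b by rewrite /g /swap /= tpermL.
have gb : g b = f a by rewrite /g /swap /= tpermR.
have gE v : v != a -> v != b -> g v = f v.
  by move=> va vb; rewrite /g /swap /= tpermD // eq_sym.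
apply/andP/andP=> [[/forallP ff nPf]|[pg nQ]].
  (* Such a path avoids [a], and also [b] because [P f] fails; there [push g] agrees with [f]. *)
  have gcut o : grounded (cut a f) o -> grounded (push g) o.
    move=> go; elim/grounded_ind: o / go => [|v gv]; first exact: grounded_None.
    rewrite -grounded_Some in gv; have [va E] := cut_groundedP gv.
    have vb : v != b by apply: contraNneq nPf => vb; rewrite /P -vb.
    rewrite grounded_Some E [grounded _ (Some v)]grounded_Some in gv *.
    rewrite pushE gE //.
    case: (f v) gv => // u /cut_groundedP[ua _].
    by rewrite /= pi_neq.
  have gab : grounded (cut a f) (f a) by apply: grounded_cut.
  have gpb : grounded (push g) (Some b).
    rewrite grounded_Some pushE gb.
    case: (f a) gab => [u gu|_]; last exact: grounded_None.
    rewrite /= pi_neq; first exact: gcut.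
    by case: (cut_groundedP gu).
  have gp o : grounded f o -> o != Some a -> grounded (push g) o.
    move=> go; elim/grounded_ind: o / go => [|v _ IH va];
      first by rewrite !grounded_None.
    have [->//|vb] := eqVneq v b.
    rewrite grounded_Some pushE gE //.
    case: (f v) IH => [u|_] /=; last by rewrite !grounded_None.
    by move=> IH; have [->|ua] := eqVneq u a; rewrite ?pi_a ?(pi_neq ua) //;
      apply: IH.
  split.
    apply/forallP=> v; have [->|va] := eqVneq v a; last exact: gp.
    rewrite grounded_Some pushE ga; case: (f b) => [u|] /=;
      last exact: grounded_None.
    by have [->|ua] := eqVneq u a; rewrite ?pi_a ?(pi_neq ua) //; apply: gp.
  (* The path from [f b] avoids [b] for [f]; if it avoids [a] for [g], then [f] and [g] agree along
     it. *)
  apply: contra nPf; rewrite /Q ga /P grounded_Some /=.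
  rewrite [b == a]eq_sym (negbTE neq_ab).
  have := grounded_cut (ff b).
  move: (f b) => o go; elim/grounded_ind: o / go => [|v gv IH gav];
    first by rewrite !grounded_None.
  have [va E1] := cut_groundedP gav.
  move: (gv); rewrite -grounded_Some => /cut_groundedP[vb E2].
  rewrite grounded_Some E1 gE // -E2 in gav; rewrite E2 in gav IH.
  by rewrite grounded_Some /= (negbTE va); apply: IH.
have Pg := forest_push_P pg.
(* Only [b] could make a difference, and [Pg] settles it. *)
have cutfg o : grounded (cut a f) o -> grounded (cut a g) o.
  move=> go; elim/grounded_ind: o / go => [|v gv];
    first by rewrite !grounded_None.
  have [->//|vb] := eqVneq v b.
  rewrite -grounded_Some in gv; have [va ->] := cut_groundedP gv.
  by rewrite [grounded _ (Some v)]grounded_Some /= (negbTE va) gE.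
have gfa : grounded f (Some a).
  rewrite grounded_Some -gb.
  have := grounded_cut (cut_grounded Pg).
  move: Pg; rewrite /P grounded_Some /= [b == a]eq_sym (negbTE neq_ab).
  move: (g b) => o gao go; elim/grounded_ind: o / go gao => [|v gv IH gav];
    first by rewrite !grounded_None.
  have [va E1] := cut_groundedP gav.
  move: (gv); rewrite -grounded_Some => /cut_groundedP[vb E2].
  rewrite grounded_Some -gE //; rewrite E2 in IH; apply: IH.
  by rewrite -E1 -grounded_Some.
split; last first.
  apply: contra nQ; rewrite /Q /P grounded_Some /=.
  rewrite [b == a]eq_sym (negbTE neq_ab) ga.
  exact: cutfg.
(* Here [f b = g a]. Its path for [push g] ends at a root, but by [nQ] its path for [g] does not do
   so without meeting [a]; hence it reaches [a], which [gfa] grounds for [f]. *)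
have gfb : grounded f (Some b).
  have H o : grounded (push g) o -> o != Some a ->
      grounded (cut a g) o || grounded f o.
    move=> go; elim/grounded_ind: o / go => [|v _ IH va].
      by rewrite !grounded_None.
    have [->|vb] := eqVneq v b; first by apply/orP; left; exact: Pg.
    rewrite !grounded_Some /= ifN // -gE //; move: IH; rewrite pushE.
    case: (g v) => [u|_]; last by rewrite !grounded_None.
    have [->|ua] := eqVneq u a; first by rewrite gfa orbT.
    by rewrite /= pi_neq //; apply.
  rewrite grounded_Some -ga; move: nQ; rewrite /Q.
  have := forallP pg a; rewrite grounded_Some pushE.
  case: (g a) => [u|]; last by rewrite !grounded_None.
  have [->//|ua] := eqVneq u a.
  by rewrite /= pi_neq // => /H/(_ ua)/orP[->|].
have H o : grounded (push g) o -> o != Some a -> grounded f o.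
  move=> go; elim/grounded_ind: o / go => [|v _ IH va];
    first by rewrite !grounded_None.
  have [->//|vb] := eqVneq v b.
  rewrite grounded_Some -gE //; move: IH; rewrite pushE.
  case: (g v) => [u|_]; last by rewrite !grounded_None.
  have [->//|ua] := eqVneq u a.
  by rewrite /= pi_neq //; apply.
apply/forallP=> v; have [->//|va] := eqVneq v a.
exact: H (forallP pg v) va.
Qed.

End Merge.
End Grounded.

(** * Weighted sums over forests *)

Section ForestSum.
Variable A : comNzRingType.

Definition forest_sum (V : finType) (W : V -> option V -> A) : A :=
  \sum_(f : {ffun V -> option V} | forest f) \prod_v W v (f v).

(** Only the heads of edges are mapped; the sources have their own type [I], so that [h] may also
    send vertices to types. *)
Definition push_weight (I U V : finType) (h : U -> V) (W : I -> option U -> A)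
    (i : I) (o : option V) : A :=
  \sum_(o' | omap h o' == o) W i o'.

Lemma eq_forest_sum (V : finType) (W W' : V -> option V -> A) :
  W =2 W' -> forest_sum W = forest_sum W'.
Proof. by move=> eqW; apply: eq_bigr => f _; apply: eq_bigr => v _. Qed.

Lemma push_weight_comp (I U V T : finType) (h : U -> V) (k : V -> T)
    (W : I -> option U -> A) :
  push_weight k (push_weight h W) =2 push_weight (k \o h) W.
Proof.
move=> i o; rewrite /push_weight.
rewrite [RHS](partition_big (omap h) (fun o' => omap k o' == o)).
  apply: eq_bigr => o' /eqP ko'; apply: eq_bigl => o0.
  have ->: omap (k \o h) o0 = omap k (omap h o0) by case: o0.
  by apply/idP/andP => [/eqP->|[]//]; rewrite ko' !eqxx.
by case.
Qed.

(** Expanding the product of sums chooses an original parent for each vertex. *)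
Lemma forest_sum_push (V : finType) (h : V -> V) (W : V -> option V -> A) :
  forest_sum (push_weight h W) =
  \sum_(f : {ffun V -> option V} | forest (omap h \o f)) \prod_v W v (f v).
Proof.
rewrite [RHS](partition_big (fun f : {ffun _ -> _} => [ffun v => omap h (f v)])
  (fun g : {ffun V -> option V} => forest g)) => [|f]; last first.
  by congr is_true; apply: eq_forest => v; rewrite ffunE.
apply: eq_bigr => g fg; rewrite /push_weight bigA_distr_big_dep.
apply: eq_bigl => f; apply/familyP/andP => [fgE|[_ /eqP<-] v].
  have {}fgE v : omap h (f v) = g v by apply/eqP/fgE.
  rewrite (eq_forest (g := g)) //; split=> //.
  by apply/eqP/ffunP => v; rewrite ffunE fgE.
by rewrite ffunE unfold_in.
Qed.

Lemma forest_sum_merge (V : finType) (a b : V) (W : V -> option V -> A) :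
    a != b -> W a =1 W b ->
  forest_sum (push_weight [eta id with a |-> b] W) = forest_sum W.
Proof.
move=> ab eqW; rewrite forest_sum_push.
pose P (f : V -> option V) := grounded (cut a f) (Some b).
pose Q (f : V -> option V) := grounded (cut a f) (f a).
(* The [Q] part on the left and the [P] part on the right run over the same functions; the remaining
   parts correspond through [swap]. *)
rewrite (bigID (fun f : {ffun _ -> _} => Q f)).
rewrite [RHS](bigID (fun f : {ffun _ -> _} => P f)) /=.
congr (_ + _); first by apply: eq_bigl => f; rewrite [RHS]forest_push_keep.
pose swap (f : {ffun V -> option V}) := [ffun v => f (tperm a b v)].
have swapK : involutive swap by move=> f; apply/ffunP => v;
  rewrite !ffunE tpermK.
rewrite (reindex_inj (inv_inj swapK)); apply: eq_big => [f|f _].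
  rewrite [RHS](forest_swap_push ab); congr (_ && ~~ _).
    by apply: eq_forest => v; rewrite /= ffunE.
  rewrite /Q /swap ffunE; apply: eq_grounded => v.
  by rewrite /cut /= ffunE.
(* The factor at [v] becomes [W (tperm a b v) (f v)], which is [W v (f v)] by [eqW]. *)
rewrite (reindex_inj (@perm_inj _ (tperm a b))); apply: eq_bigr => v _.
by rewrite ffunE tpermK; case: tpermP => // ->.
Qed.

Lemma forest_sum_retract (V : finType) (r : V -> V) (W : V -> option V -> A) :
    (forall v, r (r v) = r v) -> (forall v, W (r v) =1 W v) ->
  forest_sum (push_weight r W) = forest_sum W.
Proof.
move=> rK rW; pose p (s : seq V) v := if v \in s then r v else v.
have eq_push (h k : V -> V) : h =1 k -> push_weight h W =2 push_weight k W.
  by move=> hk v o; apply: eq_bigl => -[u|] //=; rewrite hk.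
(* Vertices are merged into their representatives one at a time; [s] lists those already treated. *)
suff H s : forest_sum (push_weight (p s) W) = forest_sum W.
  rewrite -[RHS](H (enum V)); apply/eq_forest_sum/eq_push => v.
  by rewrite /p mem_enum.
elim: s => [|a s IHs].
  apply: eq_forest_sum => v o; rewrite /push_weight (big_pred1 o) // => o'.
  by case: o'.
rewrite -{}IHs; have [ra|ra] := eqVneq a (r a).
  apply/eq_forest_sum/eq_push => v; rewrite /p inE.
  by have [->|//] := eqVneq v a; rewrite -ra if_same.
have [sa|sa] := boolP (a \in s).
  apply/eq_forest_sum/eq_push => v; rewrite /p inE.
  by have [->|//] := eqVneq v a; rewrite sa.
rewrite -(forest_sum_merge (W := push_weight (p s) W) ra) //; last first.
  by move=> o; apply: eq_bigr => o' _; rewrite rW.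
apply: eq_forest_sum => v o; rewrite push_weight_comp.
apply: eq_push => u; rewrite /p /= inE.
(* No treated vertex was sent to [a]: the values of [r] are fixed by [r], and [a] is not. *)
have [->|ua] := eqVneq u a; first by rewrite (negbTE sa) eqxx.
case: ifP => _; last by rewrite (negbTE ua).
by rewrite ifN //; apply: contraNneq ra => <-; rewrite rK.
Qed.

(** After one step, a path on the left stays among representatives, where it is the image under [r]
    of a path on [D]. *)
Lemma forest_section (V D : finType) (tg : V -> D) (r : D -> V)
    (f : V -> option V) :
  forest (omap (r \o tg) \o f) = forest (omap tg \o f \o r).
Proof.
set F := omap _ \o f; set G := _ \o r.
have FE v : F v = omap r (omap tg (f v)) by rewrite /F /=; case: (f v).
apply/forallP/forallP => [fF t|fG v].
  have H o : grounded F o -> forall o', o = omap r o' -> grounded G o'.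
    move=> go; elim/grounded_ind: o / go => [[s|] // _|v gv IH [s|//] [vs]].
      exact: grounded_None.
    by rewrite grounded_Some; apply: IH; rewrite vs FE.
  by apply: (H (Some (r t))); first exact: fF.
have H o : grounded G o -> grounded F (omap r o).
  move=> go; elim/grounded_ind: o / go => [|t gt IH];
    first exact: grounded_None.
  by rewrite /= grounded_Some FE.
rewrite grounded_Some FE; apply: H.
by case: (f v) => [u|] /=; [apply: fG|apply: grounded_None].
Qed.

Lemma forest_sum_tag (V D : finType) (tg : V -> D) (r : D -> V)
    (x : D -> option V -> A) : cancel r tg ->
  forest_sum (fun v => x (tg v)) =
    (\prod_s (\sum_o x s o) ^+ #|[pred v | tg v == s]|.-1)
    * forest_sum (push_weight tg x).
Proof.
move=> rK; rewrite -(@forest_sum_retract _ (r \o tg)) => [|v|v o] /=;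
  last 2 first.
- by rewrite rK.
- by rewrite rK.
rewrite forest_sum_push /forest_sum big_distrr /=.
rewrite (partition_big (fun f : {ffun _ -> _} => [ffun s => omap tg (f (r s))])
  (fun g : {ffun D -> option D} => forest g)) => [|f]; last first.
  rewrite forest_section; congr is_true; apply: eq_forest => v;
    by rewrite ffunE.
apply: eq_bigr => g fg.
(* With the forest [g] on types fixed, only representatives are constrained; every other vertex
   chooses its parent freely. *)
pose Z (v : V) (o : option V) := (v == r (tg v)) ==> (omap tg o == g (tg v)).
transitivity (\prod_v \sum_(o | Z v o) x (tg v) o).
  rewrite bigA_distr_big_dep; apply: eq_bigl => f.
  rewrite forest_section; apply/andP/familyP => [[_ /eqP fE] v|fZ].
    by rewrite unfold_in /Z -fE ffunE; apply/implyP => /eqP <-.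
  have {}fZ s : omap tg (f (r s)) = g s.
    by have := fZ (r s); rewrite unfold_in /Z rK eqxx => /eqP.
  rewrite (eq_forest (g := g)) //; split=> //.
  by apply/eqP/ffunP => s; rewrite ffunE fZ.
rewrite (bigID (fun v => v == r (tg v))) /= mulrC; congr (_ * _).
  rewrite (partition_big tg xpredT) //; apply: eq_bigr => s _.
  (* Setting aside the representative [r s] accounts for the predecessor in the exponent. *)
  rewrite (cardD1 (r s)) inE rK eqxx -prodr_const;
    apply: eq_big => [v|v /andP[vr /eqP vs]].
    by rewrite !inE; case: (tg v =P s) => [->|_]; rewrite ?andbT ?andbF.
  by rewrite vs; apply: eq_bigl => o; rewrite /Z (negbTE vr).
rewrite (reindex_onto r tg) => [|v /eqP//]; apply: eq_big => s.
  by rewrite rK !eqxx.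
by move=> _; rewrite rK /push_weight; apply: eq_bigl => o; rewrite /Z rK eqxx.
Qed.
End ForestSum.

(** * From rooted trees to parent functions *)

Section RootedTrees.
Variable V : finType.
Implicit Types (E : {set {set V}}) (T : {set {set V}} * V) (u v w : V).
Implicit Type f : {ffun V -> option V}.

Lemma adjC E : ssrbool.symmetric (adj E).
Proof. by move=> v w; rewrite /adj /= eq_sym setUC. Qed.

Lemma orientedP T v w :
  reflect (exists p, [/\ path (adj T.1) v (w :: p), uniq (v :: w :: p)
                       & last w p = T.2])
          (oriented T v w).
Proof.
apply: (iffP existsP) => [[k /existsP[p /and3P[pp up /eqP lp]]]|[p [pp up lp]]].
  by exists p.
have szp : (size p < #|V|)%N.
  by have := max_card (mem [:: v, w & p]); rewrite (card_uniqP up); apply: ltnW.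
exists (Ordinal szp); apply/existsP; exists (in_tuple p).
by apply/and3P; split=> //; apply/eqP.
Qed.

Lemma acyclic_ucycle E (c : seq V) :
  acyclic_graph E -> ucycleb (adj E) c -> (size c < 3)%N.
Proof.
move=> /forallP aE cc; have /andP[_ uc] := cc.
have szc : (size c < #|V|.+1)%N by rewrite ltnS -(card_uniqP uc) max_card.
by have /forallP/(_ (in_tuple c))/implyP/(_ cc) := aE (Ordinal szc).
Qed.

(** Two distinct parents would both be joined to the root without passing through [v], closing a
    cycle through [v]. *)
Lemma oriented_inj T v w w' :
  is_tree T.1 -> oriented T v w -> oriented T v w' -> w = w'.
Proof.
move=> /and3P[_ _ aT] /orientedP[p [pp up lp]] /orientedP[p' [pp' up' lp']].
apply/eqP; apply: contraT => ww'.
(* Adjacency in the tree with [v] deleted. *)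
pose e := [rel x y | [&& adj T.1 x y, x != v & y != v]].
have esym : ssrbool.symmetric e by move=> x y; rewrite /= adjC; congr (_ && _);
  rewrite andbC.
have eT x q : path (adj T.1) v (x :: q) -> uniq (v :: x :: q) ->
    last x q = T.2 -> connect e x T.2.
  move=> /andP[_ px] /andP[nv _] <-; apply/connectP; exists q => //.
  apply: (sub_in_path (P := predC1 v)) px => [y z yv zv yz|].
    by apply/and3P; split.
  by apply/allP => y yq /=; apply: contraNneq nv => <-.
have : connect e w w'.
  by apply: connect_trans (eT _ _ pp up lp) _;
    rewrite (sym_connect_sym esym) (eT _ _ pp').
case/connectP=> q0 pq0 lq0; case: (shortenP pq0) lq0 => q pq uq _ lq {q0 pq0}.
have /andP[vw _] := pp; have /andP[vw' _] := pp'.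
have qe : all (predC1 v) q.
  by elim: q (w) pq {uq lq} => //= y q IH x /andP[/and3P[_ _ ->] /IH].
have : ucycleb (adj T.1) (v :: w :: q).
  apply/andP; split; last first.
    rewrite /= -/(uniq (w :: q)) uq andbT inE negb_or; apply/andP; split.
      by case/andP: vw.
    by apply/negP => /(allP qe); rewrite /= eqxx.
  rewrite /= rcons_path vw -lq adjC vw' andbT /=.
  by apply: sub_path pq => x y /and3P[].
move=> /(acyclic_ucycle aT); case: q lq {pq uq qe} => [/= E|//].
by rewrite E eqxx in ww'.
Qed.

Lemma simple_path_to_root T v : is_tree T.1 ->
  exists p, [/\ path (adj T.1) v p, uniq (v :: p) & last v p = T.2].
Proof.
case/and3P=> _ /forallP/(_ v)/forallP/(_ T.2)/connectP[p0 pp0 lp0] _.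
by case: (shortenP pp0) lp0 => p pp up _ lp; exists p.
Qed.

Definition parent T : {ffun V -> option V} :=
  [ffun v => [pick w | oriented T v w]].

Definition parent_tree f (r : V) : {set {set V}} * V :=
  ([set [set v; w] | v in V, w in V & f v == Some w], r).

Lemma parent_oriented T v w :
  is_tree T.1 -> (parent T v == Some w) = oriented T v w.
Proof.
move=> tT; rewrite ffunE; case: pickP => [w' vw'|->//].
by apply/eqP/idP => [[<-]//|vw]; rewrite (oriented_inj tT vw vw').
Qed.

Lemma oriented_root T w : oriented T T.2 w = false.
Proof.
apply/orientedP => -[p [_ /andP[nr _] lp]].
by rewrite -lp mem_last in nr.
Qed.

Lemma parent_None T v : is_tree T.1 -> (parent T v == None) = (v == T.2).
Proof.
move=> tT; rewrite ffunE; have [->|vr] := eqVneq v T.2.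
  by case: pickP => // w; rewrite oriented_root.
case: pickP => // no; have [[|w p] [pp up lp]] := simple_path_to_root v tT.
  by rewrite -lp eqxx in vr.
by case/orientedP: (negbT (no w)); exists p.
Qed.

Lemma forest_parent T : is_tree T.1 -> forest (parent T).
Proof.
move=> tT; apply/forallP=> v; have [p [pp up lp]] := simple_path_to_root v tT.
elim: p v pp up lp => [|w p IH] v pp up lp; rewrite grounded_Some.
  by rewrite (eqP (_ : parent T v == None)) ?grounded_None // parent_None //;
    apply/eqP.
rewrite (eqP (_ : parent T v == Some w)); last first.
  by rewrite parent_oriented //; apply/orientedP; exists p.
by apply: IH; [case/andP: pp|case/andP: up|].
Qed.

Lemma parentK T : is_tree T.1 -> parent_tree (parent T) T.2 = T.
Proof.
move=> tT; rewrite [RHS]surjective_pairing; congr (_, _); apply/setP=> e.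
have /and3P[/forallP sT _ _] := tT.
apply/imset2P/idP => [[v w _]|eT].
  rewrite inE /= parent_oriented // => /orientedP[p [/andP[vw _] _ _]] ->.
  by case/andP: vw.
have /implyP/(_ eT)/cards2P[v [w [vw Ee]]] := sT e.
have avw : adj T.1 v w by apply/andP; rewrite -Ee.
have [p [pp up lp]] := simple_path_to_root w tT.
(* If the simple path from [w] to the root misses [v], prefixing [v] orients the edge towards [w].
   Otherwise [w] followed by the tail of the path from [v] on orients it towards [v]. *)
have [vp|vp] := boolP (v \in w :: p); last first.
  exists v w; rewrite ?inE //= parent_oriented //; apply/orientedP; exists p.
  by split=> //; [rewrite /= pp andbT|rewrite cons_uniq vp].
exists w v; rewrite ?inE //=; last by rewrite setUC.
rewrite parent_oriented //; apply/orientedP.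
rewrite inE (negbTE vw) /= in vp; case/splitPr: vp pp up lp => p1 p2 pp up lp.
exists p2; split.
- by rewrite /= adjC avw; move: pp; rewrite cat_path => /and3P[].
- by apply: subseq_uniq up; rewrite /= eqxx suffix_subseq.
- by rewrite last_cat in lp.
Qed.

End RootedTrees.

(** * From parent functions back to rooted trees *)

Section ForestTrees.
Variable V : finType.
Implicit Types (u v w r : V) (f : {ffun V -> option V}).

Definition rooted_forest r f :=
  forest f && [forall v, (f v == None) == (v == r)].

Lemma adj_parent_tree f r v w : forest f ->
  adj (parent_tree f r).1 v w = (f v == Some w) || (f w == Some v).
Proof.
move=> /forest_rank[ht htP].
have neq x y : f x == Some y -> x != y.
  by move=> /eqP/htP; apply: contraTneq => ->; rewrite ltnn.
apply/andP/orP => [[vw /imset2P[x y _]]|[vw|vw]].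
- rewrite inE /= => fx E.
  have : v \in [set x; y] by rewrite -E set21.
  have : w \in [set x; y] by rewrite -E set22.
  rewrite !inE => /orP[] /eqP Ew /orP[] /eqP Ev; move: vw fx;
    rewrite Ew Ev ?eqxx //.
  + by right.
  + by left.
- by split; [apply: neq|apply/imset2P; exists v w; rewrite ?inE].
- split; first by rewrite eq_sym neq.
  by apply/imset2P; exists w v; rewrite ?inE // setUC.
Qed.

Lemma parent_path f r v : rooted_forest r f ->
  exists2 p, path [rel x y | f x == Some y] v p & last v p = r.
Proof.
case/andP=> /forallP/(_ v) gv /forallP fr.
suff H o : grounded f o -> forall v, o = Some v ->
    exists2 p, path [rel x y | f x == Some y] v p & last v p = r.
  exact: H gv v erefl.
move=> go; elim/grounded_ind: o / go => // z _ IH x [<-].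
case fz: (f z) IH => [u|] IH; last by exists [::]; rewrite //=; apply/eqP;
  rewrite -(eqP (fr z)) fz.
by have [p pp lp] := IH u erefl; exists (u :: p); rewrite //= fz eqxx.
Qed.

Lemma is_tree_parent_tree f r :
  rooted_forest r f -> is_tree (parent_tree f r).1.
Proof.
move=> rf; have /andP[ff /forallP fr] := rf; have [ht htP] := forest_rank ff.
have adjE v w := @adj_parent_tree f r v w ff.
apply/and3P; split.
- apply/forallP => e; apply/implyP => /imset2P[v w _]; rewrite inE /= => fv ->.
  by rewrite cards2 (contraTneq _ (htP _ _ (eqP fv))) // => ->; rewrite ltnn.
- have conn v : connect (adj (parent_tree f r).1) v r.
    have [p pp <-] := parent_path v rf; apply/connectP; exists p => //.
    by apply: sub_path pp => x y /= xy; rewrite adjE xy.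
  apply/forallP => v; apply/forallP => w; apply: connect_trans (conn v) _.
  by rewrite (sym_connect_sym (@adjC _ _)) conn.
(* Both neighbours of a vertex of maximal rank on a cycle would be its parent. *)
- apply/forallP => k; apply/forallP => c; apply/implyP => /andP[cc uc].
  rewrite -(size_tuple c) ltnNge; apply/negP => szc.
  have [x0 x0c] : exists x, x \in (c : seq V).
    by case: (tval c) szc => // x s _; exists x; rewrite inE eqxx.
  case: (@arg_maxnP _ x0 (mem (c : seq V)) ht x0c) => v vc vmax.
  have [i s Ei] := rot_to vc.
  have mc u : u \in v :: s -> (ht u <= ht v)%N.
    by rewrite -Ei mem_rot => /vmax.
  rewrite -(rot_cycle i) Ei in cc; rewrite -(rot_uniq i) Ei in uc.
  rewrite -(size_rot i) Ei in szc.
  have up u : u \in v :: s -> adj (parent_tree f r).1 v u -> f v = Some u.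
    move=> us; rewrite adjE => /orP[/eqP//|/eqP/htP].
    by rewrite ltnNge mc.
  case: s {Ei} szc cc uc mc up => [//|x [//|y s]] _.
  rewrite (cycle_path v) [last _ _]/= => /andP[va /andP[vx _]].
  move=> /andP[_ /andP[xn _]] _ up.
  rewrite adjC in va.
  have Ex : f v = Some x by apply: up vx; rewrite !inE eqxx orbT.
  have El : f v = Some (last y s).
    by apply: up va; rewrite 2!in_cons mem_last !orbT.
  by move: xn; rewrite Ex in El; case: El => ->; rewrite mem_last.
Qed.

Lemma oriented_parent_tree f r v w :
  rooted_forest r f -> oriented (parent_tree f r) v w = (f v == Some w).
Proof.
move=> rf; have /andP[ff /forallP fr] := rf.
have tT := is_tree_parent_tree rf.
have H u : f v = Some u -> oriented (parent_tree f r) v u.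
  move=> fv; have [p pp lp] := parent_path u rf.
  have pvp : path [rel x y | f x == Some y] v (u :: p) by rewrite /= fv eqxx.
  apply/orientedP; exists p; split=> //.
    by apply: sub_path pvp => x y /= xy; rewrite adj_parent_tree // xy.
  have [ht htP] := forest_rank ff.
  (* The parent path is simple because the rank strictly decreases along it. *)
  apply: (@sorted_uniq _ [rel x y | (ht y < ht x)%N]).
  - by move=> y x z /= yx zy; apply: ltn_trans zy yx.
  - by move=> x /=; rewrite ltnn.
  - by apply: sub_path pvp => x y /= /eqP /htP.
apply/idP/eqP => [vw|/H//].
case fv: (f v) => [u|]; first by rewrite (oriented_inj tT vw (H u fv)).
have vr : v = r by apply/eqP; rewrite -(eqP (fr v)) fv.
by move: vw; rewrite vr (oriented_root (parent_tree f r)).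
Qed.

Lemma parent_treeK f r : rooted_forest r f -> parent (parent_tree f r) = f.
Proof.
move=> rf; apply/ffunP => v; have tT := is_tree_parent_tree rf.
case fv: (f v) => [u|].
  by apply/eqP; rewrite parent_oriented // oriented_parent_tree // fv.
apply/eqP; rewrite parent_None //.
by case/andP: rf => _ /forallP/(_ v)/eqP <-; rewrite fv.
Qed.

(** Each vertex other than the root is the tail of exactly one oriented edge; the root contributes
    the default 1 of [oapp]. *)
Lemma sum_rooted_trees (A : comNzRingType) (r : V) (x : V -> V -> A) :
  \sum_(T in rooted_trees V | T.2 == r)
     \prod_(e : V * V | oriented T e.1 e.2) x e.1 e.2
  = \sum_(f | rooted_forest r f) \prod_v oapp (x v) 1 (f v).
Proof.
rewrite (reindex_onto (fun f => parent_tree f r) (@parent V)) /=; last first.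
  by move=> T /andP[]; rewrite inE => tT /eqP <-; rewrite parentK.
apply: eq_big => [f|f].
  rewrite inE eqxx andbT; apply/andP/idP => [[tT /eqP fE]|rf].
    rewrite /rooted_forest -[in forest _]fE forest_parent //=.
    by apply/forallP => v; rewrite -[in f v]fE parent_None.
  by rewrite is_tree_parent_tree // parent_treeK.
move=> /andP[]; rewrite inE eqxx andbT => tT /eqP fE.
rewrite -(pair_big_dep xpredT (oriented (parent_tree f r)) x) /=.
apply: eq_bigr => v _; case fv: (f v) => [u|] /=.
  rewrite (big_pred1 u) // => w; rewrite -parent_oriented // fE fv /=.
  by rewrite eq_sym; apply/eqP/eqP => [[]|->].
by rewrite big_pred0 // => w; rewrite -parent_oriented // fE fv.
Qed.

End ForestTrees.

(** * Extracting trees from forests by marking roots *)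

Section RootMarking.
Variable A : comNzRingType.

Definition root_weight (V : finType) (P : pred V) (x : V -> V -> A) (v : V)
    (o : option V) : {poly A} :=
  if o is Some u then (x v u)%:P else (P v)%:R *: 'X.

Lemma big_Some (V : finType) (B : comNzRingType) (P : pred (option V))
    (F : option V -> B) : ~~ P None ->
  \sum_(o | P o) F o = \sum_(v | P (Some v)) F (Some v).
Proof.
move=> nP; rewrite (@reindex_omap _ _ _ _ _ Some id) => [|[v|]//]; last first.
  by move=> PN; rewrite PN in nP.
by apply: eq_bigl => v; rewrite eqxx andbT.
Qed.

(** The product is a constant times a power of ['X] whose exponent counts the roots, and the
    constant vanishes if some root is outside [P]. *)
Lemma coef1_root_weight (V : finType) (P : pred V) (x : V -> V -> A)
    (f : V -> option V) :
  (\prod_v root_weight P x v (f v))`_1 =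
  \sum_(r | P r && [forall v, (f v == None) == (v == r)])
     \prod_v oapp (x v) 1 (f v).
Proof.
have [r fr|nf] := pickP (fun r => f r == None); last first.
  rewrite [RHS]big_pred0 => [|r]; last first.
    by apply: contraFF (nf r) => /andP[_ /forallP H]; rewrite (eqP (H r)).
  rewrite (eq_bigr (fun v => (oapp (x v) 1 (f v))%:P)) => [|v _].
    by rewrite -rmorph_prod /= coefC.
  by have := nf v; rewrite /root_weight; case: (f v).
rewrite (bigD1 r) //= /root_weight (eqP fr) -scalerAl coefZ coefXM /=.
have [/forallP f1|] := boolP [forall v, (f v == None) == (v == r)].
  rewrite (eq_bigr (fun v => (oapp (x v) 1 (f v))%:P)) => [|v vr]; last first.
    have := f1 v; rewrite (negbTE vr) eqbF_neg.
    by case: (f v).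
  rewrite -rmorph_prod /= coefC eqxx.
  have only r' : [forall v, (f v == None) == (v == r')] -> r' = r.
    by move=> /forallP/(_ r); rewrite fr => /eqP/esym/eqP->.
  have [Pr|nPr] := boolP (P r).
    rewrite [RHS](big_pred1 r) => [|r'].
      by rewrite [RHS](bigD1 r) //= (eqP fr).
    apply/andP/eqP => [[_ /only]//|->]; split=> //; exact/forallP.
  rewrite mul0r [RHS]big_pred0 // => r';
    apply/negbTE/negP => /andP[Pr' /only E].
  by rewrite -E Pr' in nPr.
(* A second root [v] brings another factor ['X], so the coefficient is 0. *)
rewrite negb_forall => /existsP[v].
have [->|vr] := eqVneq v r; first by rewrite fr.
rewrite eqbF_neg negbK => fv.
rewrite (bigD1 v) //= (eqP fv) -scalerAl coefZ coefXM /= !mulr0.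
rewrite [RHS]big_pred0 // => r'; apply/negbTE/negP => /andP[_ /forallP H].
have /eqP := H v; have /eqP := H r; rewrite fr fv => /esym/eqP Er /esym/eqP Ev.
by rewrite Ev Er eqxx in vr.
Qed.

Lemma coef1_forest_sum (V : finType) (P : pred V) (x : V -> V -> A) :
  (forest_sum (root_weight P x))`_1 =
  \sum_(T in rooted_trees V | P T.2)
     \prod_(e : V * V | oriented T e.1 e.2) x e.1 e.2.
Proof.
rewrite [RHS](partition_big (fun T => T.2) P) => [|T /andP[]//].
rewrite coef_sum.
rewrite (eq_bigr _ (fun f : {ffun _ -> _} => fun _ => coef1_root_weight P x f)).
rewrite (exchange_big_dep P) => [|f r _ /andP[]//]; apply: eq_bigr => r Pr.
transitivity (\sum_(f | rooted_forest r f) \prod_v oapp (x v) 1 (f v)).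
  by apply: eq_bigl => f; rewrite Pr.
rewrite -sum_rooted_trees; apply: eq_bigl => T.
by case: eqP => [->|]; rewrite ?Pr ?andbT ?andbF.
Qed.

(** Following parents from [v0] reaches a root, whose weight is a multiple of ['X]. *)
Lemma coef0_forest_sum (V : finType) (P : pred V) (x : V -> V -> A) (v0 : V) :
  (forest_sum (root_weight P x))`_0 = 0.
Proof.
rewrite coef_sum big1 // => f /forallP/(_ v0) gf.
have [r fr] : exists r, f r = None.
  suff H o : grounded f o -> o -> exists r, f r = None by exact: H gf isT.
  move=> go; elim/grounded_ind: o / go => // v _; case fv: (f v) => [u|] IH _.
    exact: IH.
  by exists v.
by rewrite (bigD1 r) //= {1}/root_weight fr -scalerAl coefZ coefXM mulr0.
Qed.

End RootMarking.

(** * Multitype trees *)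

Lemma prod_ch (R : comNzRingType) (d : nat) (n : 'I_d -> nat)
    (T : {set {set vertex n}} * vertex n) :
  \prod_(s < d) \prod_(t < d) \prod_(i < n t) xvar R s t i ^+ ch T s t i =
  \prod_(e : vertex n * vertex n | oriented T e.1 e.2)
     'X_(enum_rank (tag e.1, e.2)) :> {mpoly R[nvars n]}.
Proof.
(* Edges are grouped by head, then by the type of the tail; the sizes of the groups are the
   exponents [ch]. *)
rewrite -(pair_big_dep xpredT (oriented T)
  (fun u v => 'X_(enum_rank (tag u, v)) : {mpoly R[nvars n]})) /=.
rewrite [RHS](exchange_big_dep xpredT) //=.
transitivity (\prod_(s < d) \prod_(w : vertex n)
  ('X_(enum_rank (s, w)) : {mpoly R[nvars n]}) ^+
   #|[set u : vertex n | oriented T u w & tag u == s]|).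
  apply: eq_bigr => s _; rewrite sig_big_dep.
  apply: eq_big => [p|[t i] _]; first by rewrite andbT.
  by rewrite /xvar /ch /vtx /Tagged /=.
rewrite exchange_big; apply: eq_bigr => w _ /=.
rewrite [RHS](partition_big (fun u : vertex n => tag u) xpredT) //=;
  apply: eq_bigr => s _.
rewrite -prodr_const; apply: eq_big => [u|u]; first by rewrite inE.
by rewrite inE => /andP[_ /eqP->].
Qed.

Lemma big_vertex (A : Type) (idx : A) (op : Monoid.com_law idx) (d : nat)
    (n : 'I_d -> nat) (t : 'I_d) (F : vertex n -> A) :
  \big[op/idx]_(u : vertex n | tag u == t) F u =
  \big[op/idx]_(i < n t) F (vtx i).
Proof.
rewrite -(big_pred1_eq op t (fun t => \big[op/idx]_(i < n t) F (vtx i))).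
rewrite sig_big_dep; apply: eq_big => [u|[s i] _ //].
by rewrite andbT.
Qed.

Theorem theorem2p1 (R : comNzRingType) (d : nat) (n : 'I_d -> nat)
    (n_gt0 : forall t : 'I_d, (0 < n t)%N) (rho : 'I_d) :
  \sum_(T in multitype_trees n rho)
     \prod_(s < d) \prod_(t < d) \prod_(i < n t) xvar R s t i ^+ ch T s t i
  = (\prod_(s < d) (\sum_(t < d) \sum_(i < n t) xvar R s t i) ^+ (n s - 1))
    * \sum_(A in Cay rho)
        \prod_(e : 'I_d * 'I_d | oriented A e.1 e.2)
          \sum_(i < n e.2) xvar R e.1 e.2 i
  :> {mpoly R[nvars n]}.
Proof.
under eq_bigr do rewrite prod_ch.
pose x (s : 'I_d) (v : vertex n) : {mpoly R[nvars n]} := 'X_(enum_rank (s, v)).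
pose y (s t : 'I_d) := \sum_(i < n t) xvar R s t i.
pose W (s : 'I_d) (o : option (vertex n)) : {poly {mpoly R[nvars n]}} :=
  if o is Some u then (x s u)%:P else (s == rho)%:R *: 'X.
have xE s t : \sum_(u | tag u == t) x s u = y s t.
  exact: big_vertex.
have pushE : push_weight tag W =2 root_weight (pred1 rho) y.
  move=> s [t|]; rewrite /push_weight;
    last by rewrite (big_pred1 None) // => -[].
  rewrite big_Some //= -rmorph_sum; congr (_%:P); rewrite -xE.
  by apply: eq_bigl => u; apply/eqP/eqP => [[]|->].
have cardE t : #|[pred v : vertex n | tag v == t]| = n t.
  by rewrite -sum1_card big_vertex sum1_card card_ord.
pose Wv := root_weight (fun v : vertex n => tag v == rho) (fun v => x (tag v)).
transitivity (forest_sum Wv)`_1.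
  by rewrite coef1_forest_sum; apply: eq_bigl => T; rewrite inE.
have -> : forest_sum Wv = forest_sum (fun v => W (tag v)).
  by apply: eq_forest_sum => v [].
(* The representative of each type is its first vertex, which exists by [n_gt0]. *)
rewrite (@forest_sum_tag _ _ _ tag (fun s => vtx (Ordinal (n_gt0 s)))) //.
(* The forest sum over types has constant coefficient 0, so only the constant coefficient of the
   powers survives. Evaluating them at 0 computes it and discards the root weights. *)
rewrite (eq_forest_sum pushE) coefM big_ord_recl big_ord1 /= subn0 subnn.
rewrite coef0_forest_sum // mulr0 addr0 coef1_forest_sum.
rewrite -horner_coef0 horner_prod.
congr (_ * _).
  apply: eq_bigr => s _; rewrite horner_exp cardE -subn1; congr (_ ^+ _).
  rewrite (bigD1 None) //= hornerD hornerZ hornerX mulr0 add0r.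
  rewrite big_Some //= -rmorph_sum hornerC sig_big_dep /=.
  by apply: eq_bigr => -[].
by apply: eq_bigl => T; rewrite [in RHS]inE.
Qed.
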